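(* Let $0\le p<m$, let $\xi_0$ be a constant $(m-p)$-form on $\mathbb R^m$, and suppose the smooth $p$-form $\omega$ on $\mathbb R^m$ is a solution of $$d*\left(\frac{d\omega}{\sqrt{1+|d\omega|^2}}\right)=\xi_0$$ on $\mathbb R^m$. Then $\xi_0=0$.
   Context: $*$ is the Hodge star operator of the Euclidean metric on $\mathbb R^m$, and $|\cdot|$ is the pointwise Euclidean norm of differential forms, for which the forms $dx_{j_1}\wedge\cdots\wedge dx_{j_k}$, $j_1<\cdots<j_k$, are orthonormal. A constant form is one with constant coefficients in the standard coordinates. *)

(* Defs.v *)
From HB Require Import structures.
From mathcomp Require Import all_boot all_order all_algebra.
From mathcomp Require Import all_classical all_reals all_analysis.

Set Implicit Arguments.
Unset Strict Implicit.
Unset Printing Implicit Defensive.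

Import Order.TTheory GRing.Theory Num.Theory.
Import numFieldNormedType.Exports.

Local Open Scope ring_scope.

Section ExteriorAlgebra.
Context {R : realType} {m : nat}.

(* The value a I is the coefficient of dx_I := dx_{j_1} /\ ... /\ dx_{j_k},
   where I = {j_1 < ... < j_k}; all degrees 0 <= k <= m live together. *)
Definition extalg := {ffun {set 'I_m} -> R^o}.

Definition homogeneous (k : nat) (a : extalg) : Prop :=
  forall I : {set 'I_m}, #|I| != k -> a I = 0.

Definition dx (I : {set 'I_m}) : extalg := [ffun K => (K == I)%:R].

(* For disjoint I and J, dx_I /\ dx_J = shuffle_sign I J dx_(I :|: J). *)
Definition shuffle_sign (I J : {set 'I_m}) : R :=
  (-1) ^+ #|[set ij : 'I_m * 'I_m |
               [&& ij.1 \in I, ij.2 \in J & (ij.2 < ij.1)%N]]|.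

Definition wedge (a b : extalg) : extalg :=
  [ffun K : {set 'I_m} => \sum_(I : {set 'I_m} | I \subset K)
     shuffle_sign I (K :\: I) * (a I * b (K :\: I))].

Definition extdot (a b : extalg) : R := \sum_(I : {set 'I_m}) a I * b I.

Definition extnorm (a : extalg) : R := Num.sqrt (extdot a a).

(* * dx_I = shuffle_sign I (~: I) dx_(~: I), for the standard orientation;
   see wedge_hodge below. *)
Definition hodge (a : extalg) : extalg :=
  [ffun K : {set 'I_m} => shuffle_sign (~: K) K * a (~: K)].

Lemma wedge_hodge (k : nat) (a b : extalg) :
  homogeneous k a -> homogeneous k b ->
  wedge a (hodge b) = extdot a b *: dx [set: 'I_m].
Proof.
move=> ha hb; apply/ffunP => K; rewrite !ffunE.
have [->|KT] := eqVneq K [set: 'I_m].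
  rewrite [RHS]mulr1; apply: eq_big => [I|I _]; first exact: finset.subsetT.
  rewrite finset.setTD ffunE finset.setCK mulrCA; congr (_ * _).
  by rewrite mulrA -expr2 sqrr_sign mul1r.
rewrite [RHS]mulr0 big1 // => I IK; rewrite ffunE.
have [cI|cI] := eqVneq #|I| k; last by rewrite ha // mul0r mulr0.
rewrite (hb (~: (K :\: I))) ?mulr0 // finset.setCD -cI.
have dKI : [disjoint ~: K & I].
  by rewrite -finset.setI_eq0 finset.setIC -finset.setDE finset.setD_eq0.
rewrite cardsU (disjoint_setI0 dKI) cards0 subn0 -[X in _ != X]add0n eqn_add2r.
by rewrite cards_eq0 -[finset.set0]finset.setCT (inj_eq (@finset.setC_inj _)).
Qed.

End ExteriorAlgebra.

Arguments extalg : clear implicits.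

Section Forms.
Context {R : realType} {m : nat}.

Definition dform := 'rV[R]_m -> extalg R m.

Definition has_degree (k : nat) (w : dform) : Prop :=
  forall x, homogeneous k (w x).

Definition constant_form (w : dform) : Prop := forall x y, w x = w y.

Definition partial (i : 'I_m) (f : 'rV[R]_m -> R) : 'rV[R]_m -> R :=
  fun x => 'D_(delta_mx 0 i) f x.

Definition iter_partial (s : seq 'I_m) (f : 'rV[R]_m -> R) : 'rV[R]_m -> R :=
  foldr partial f s.

(* C^oo: iterated partial derivatives of all orders exist and are
   continuous. *)
Definition smooth_fun (f : 'rV[R]_m -> R) : Prop :=
  forall s : seq 'I_m,
    continuous (iter_partial s f) /\
    forall (i : 'I_m) (x : 'rV[R]_m),
      derivable (iter_partial s f) x (delta_mx 0 i).

Definition smooth_form (w : dform) : Prop :=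
  forall I : {set 'I_m}, smooth_fun (fun x => w x I).

Definition partial_form (i : 'I_m) (w : dform) : dform :=
  fun x => [ffun I : {set 'I_m} => partial i (fun y => w y I) x].

(* d w = \sum_i dx_i /\ (d w / d x_i) *)
Definition extd (w : dform) : dform :=
  fun x => \sum_(i < m) wedge (dx [set i]) (partial_form i w x).

End Forms.

Arguments dform : clear implicits.

(* Main.v *)
Require Import Defs.
From HB Require Import structures.
From mathcomp Require Import all_boot all_order all_algebra.
From mathcomp Require Import all_classical all_reals all_analysis.
From mathcomp Require Import ring lra.

(** Every coefficient of the flux form [* (dw / sqrt (1 + |dw|^2))] is bounded
    by 1, whatever the size of [dw], because [t / sqrt (1 + t^2) < 1].  The
    coefficient of [dx_K] in the exterior derivative of the flux form is, up to
    signs, the divergence of a vector field whose components are coefficients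
    of the flux form.  So the equation says that, for each [K], a bounded [C^1]
    vector field on the whole space has constant divergence [c], the
    [K]-coefficient of [xi0].  Such a [c] vanishes
    ([constant_divergence_eq0]): over a cube of side [L] the total divergence
    is [c L^m], while the flux through the boundary is only [O(L^(m-1))].

    The comparison of volume and boundary is carried out on a lattice, with
    finite sums instead of integrals.  On a compact set, the difference
    quotients of step [h] converge uniformly to the partial derivatives as [h]
    tends to 0 (mean value theorem and compactness,
    [diffq_uniform_on_compact]), so the sum of the difference quotients of the
    components of the field is uniformly close to [c] there.  Averaging it over
    a lattice box with [N] steps of length [h] in each direction therefore
    gives nearly [c].  On the other hand, averaging a difference quotient along
    its own direction telescopes, which leaves at most [2 b / (N h)] when the
    component is bounded by [b] ([avgs_diffq_le]).  Taking [L = N h] large, and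
    then [h] small, gives [c = 0]. *)

Set Implicit Arguments.
Unset Strict Implicit.
Unset Printing Implicit Defensive.
Import Order.TTheory GRing.Theory Num.Theory.
Import numFieldNormedType.Exports.
Local Open Scope classical_set_scope.
Local Open Scope ring_scope.

(** * Functions of class C^1 along a direction *)

Section C1.
Context {R : realType} {V : normedModType R}.
Implicit Types (f g : V -> R) (v x : V).

Definition C1_along v f :=
  [/\ continuous f, forall x, derivable f x v & continuous ('D_v f)].

Lemma C1_along_eq v f (df : V -> R) : continuous f -> continuous df ->
  (forall x, is_derive x v f (df x)) -> C1_along v f.
Proof.
move=> cf cdf dfE; split=> [//|x|]; first exact: ex_derive.
by rewrite (_ : 'D_v f = df) //; apply/funext => x; exact: derive_val.
Qed.

Lemma C1_along_cst v (c : R) : C1_along v (fun=> c).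
Proof. by apply: (@C1_along_eq _ _ (fun=> 0)) => x; exact: cst_continuous. Qed.

Lemma C1_alongD v f g : C1_along v f -> C1_along v g ->
  C1_along v (fun x => f x + g x).
Proof.
move=> [cf df cDf] [cg dg cDg].
apply: (@C1_along_eq _ _ (fun x => 'D_v f x + 'D_v g x)) => x.
- by apply: cvgD; [exact: cf|exact: cg].
- by apply: cvgD; [exact: cDf|exact: cDg].
- by apply: is_deriveD; apply: derivableP.
Qed.

Lemma C1_alongM v f g : C1_along v f -> C1_along v g ->
  C1_along v (fun x => f x * g x).
Proof.
move=> [cf df cDf] [cg dg cDg].
apply: (@C1_along_eq _ _ (fun x => f x *: 'D_v g x + g x *: 'D_v f x)) => x.
- by apply: cvgM; [exact: cf|exact: cg].
- by apply: cvgD; apply: cvgM;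
    [exact: cf|exact: cDg|exact: cg|exact: cDf].
- by apply: is_deriveM; apply: derivableP.
Qed.

Lemma C1_along_sum v (I : Type) (r : seq I) (P : pred I) (F : I -> V -> R) :
  (forall i, C1_along v (F i)) ->
  C1_along v (fun x => \sum_(i <- r | P i) F i x).
Proof.
move=> CF; rewrite (_ : (fun x => _) = \sum_(i <- r | P i) F i); last first.
  by apply/funext => x; rewrite fct_sumE.
elim/big_ind: _ => [|f g|i _]; [exact: C1_along_cst|exact: C1_alongD|exact: CF].
Qed.

Lemma C1_alongV v f : (forall x, f x != 0) -> C1_along v f ->
  C1_along v (fun x => (f x)^-1).
Proof.
move=> f0 [cf df cDf].
have cV : continuous (fun x => (f x)^-1).
  by move=> x; apply: cvgV; [exact: f0|exact: cf].
apply: (@C1_along_eq _ _ (fun x => - ((f x)^-1 * (f x)^-1) * 'D_v f x)) => // x.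
- by apply: cvgM; [apply: cvgN; apply: cvgM; exact: cV|exact: cDf].
- split; first exact: derivableV.
  by rewrite deriveV // expr2 invfM.
Qed.

(** Restricting [f] to a line turns a derivative along [v] into an ordinary one,
    to which the one-variable chain rule and mean value theorem apply. *)
Lemma is_derive_line v f x (t : R) : derivable f (t *: v + x) v ->
  is_derive t 1 (fun t : R => f (t *: v + x)) ('D_v f (t *: v + x)).
Proof.
move=> df.
have E : (fun h : R => h^-1 *:
    (((fun s : R => f (s *: v + x)) \o shift t) (h *: (1 : R)) - f (t *: v + x))) =
  (fun h => h^-1 *: ((f \o shift (t *: v + x)) (h *: v) - f (t *: v + x))).
  by apply/funext => h /=; rewrite [_%:A]mulr1 scalerDl addrA.
by split; rewrite ?/derivable /derive E.
Qed.

Lemma is_derive_sqrt_comp v f x : 0 < f x -> derivable f x v ->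
  is_derive x v (fun y => Num.sqrt (f y)) ((2 * Num.sqrt (f x))^-1 * 'D_v f x).
Proof.
move=> f0 df; have x0 : 0 *: v + x = x by rewrite scale0r add0r.
have d : is_derive (0 : R) 1 (fun t : R => f (t *: v + x)) ('D_v f x).
  by rewrite -[x in 'D_v f x]x0; apply: is_derive_line; rewrite x0.
have ds : is_derive (f (0 *: v + x)) 1 Num.sqrt (2 * Num.sqrt (f x))^-1.
  by rewrite x0; apply: is_derive1_sqrt.
have [dc dv] := @is_derive1_comp _ _ _ _ _ _ ds d.
split; first by apply: (derivable1P _ _ _).2.
rewrite -dv /derive; congr (lim (_ @ 0^')); apply/funext => h /=.
by rewrite addr0 scale0r add0r [_%:A]mulr1.
Qed.

Lemma C1_along_sqrt v f : (forall x, 0 < f x) -> C1_along v f ->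
  C1_along v (fun x => Num.sqrt (f x)).
Proof.
move=> f0 [cf df cDf].
have cs : continuous (fun x => Num.sqrt (f x)).
  by move=> x; apply: continuous_comp; [exact: cf|exact: sqrt_continuous].
apply: (@C1_along_eq _ _ (fun x => (2 * Num.sqrt (f x))^-1 * 'D_v f x)) => // x.
- apply: cvgM; last exact: cDf.
  apply: cvgV; last by apply: cvgM; [exact: cst_continuous|exact: cs].
  by rewrite mulf_neq0 // ?pnatr_eq0 // gt_eqF // sqrtr_gt0.
- exact: is_derive_sqrt_comp.
Qed.

Lemma MVT_line v f x (h : R) : 0 < h -> (forall y, derivable f y v) ->
  exists2 t, 0 < t < h & f (h *: v + x) - f x = h * 'D_v f (t *: v + x).
Proof.
move=> h0 df.
have dg (t : R) := is_derive_line (df (t *: v + x)).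
have [t|t th E] := MVT h0 (fun t _ => dg t).
  apply: continuous_subspaceT => s.
  by apply/differentiable_continuous/derivable1_diffP; apply: ex_derive.
exists t; first by rewrite in_itv /= in th.
by rewrite scale0r add0r subr0 mulrC in E.
Qed.

End C1.

(** * Difference quotients and their averages over a lattice *)

Section DiffQuot.
Context {R : realType} {V : normedModType R}.
Implicit Types (f g : V -> R) (v x : V) (h : R).

Definition diffq h v f x : R := h^-1 * (f (h *: v + x) - f x).

(** By the mean value theorem the quotient at [y] is the value of ['D_v f] at a
    point within [h |v|] of [y], hence close to ['D_v f y] when [y] stays near a
    given point of [K] and [h] is small; compactness makes the choice of [h]
    uniform over [K]. *)
Lemma diffq_uniform_on_compact (K : set V) v f (e : R) :
  compact K -> 0 < e -> C1_along v f ->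
  \forall h \near 0^'+, forall x, K x -> `|diffq h v f x - 'D_v f x| <= e.
Proof.
move=> cK e0 [_ df cDf].
have /compact_near_coveringP cov := cK.
apply: cov => x Kx /=.
have /cvgrPdist_lt /(_ (e / 2)) : 'D_v f y @[y --> x] --> 'D_v f x by exact: cDf.
move=> /(_ (divr_gt0 e0 (ltr0n _ 2))) /nbhs_ballP [r /= r0 near_x].
near=> y h => /=.
have h0 : 0 < h by near: h; exact: nbhs_right_gt.
have [t /andP[t0 th] E] := MVT_line y h0 df.
rewrite /diffq E mulKf ?gt_eqF //.
have xy : `|x - y| < r / 2.
  by near: y; apply: (@cvgr_dist_lt _ _ _ _ _ id) => //; rewrite divr_gt0.
have hv : h * (`|v| + 1) < r / 2.
  (* The summand 1 keeps the divisor positive when v = 0. *)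
  rewrite -ltr_pdivlMr ?ltr_wpDl //; near: h; apply: nbhs_right_lt.
  by rewrite !divr_gt0 // ltr_wpDl.
have tv : `|t *: v| < r / 2.
  apply: le_lt_trans hv; rewrite normrZ gtr0_norm //.
  by apply: ler_pM; rewrite ?normr_ge0 ?lerDl // ltW.
have Dy : `|'D_v f x - 'D_v f y| < e / 2.
  by apply: near_x; rewrite -ball_normE /=; lra.
have Dt : `|'D_v f x - 'D_v f (t *: v + y)| < e / 2.
  apply: near_x; rewrite -ball_normE /= [_ + y]addrC opprD addrA.
  by apply: (le_lt_trans (ler_normB _ _)); lra.
rewrite (_ : _ - _ = ('D_v f x - 'D_v f y) - ('D_v f x - 'D_v f (t *: v + y))).
  by apply: (le_trans (ler_normB _ _)); lra.
by rewrite opprB [RHS]addrC subrKA.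
Unshelve. all: by end_near. Qed.

End DiffQuot.

Section Averages.
Context {R : realType} {V : normedModType R}.
Variables (h : R) (N : nat).
Hypotheses (h_gt0 : 0 < h) (N_gt0 : (0 < N)%N).
Implicit Types (f g : V -> R) (v x : V) (s : seq V).

Definition avg v f x : R := N%:R^-1 * \sum_(k < N) f ((h *+ k) *: v + x).

Definition avgs s f : V -> R := foldr avg f s.

Let N_neq0 : N%:R != 0 :> R. Proof. by rewrite pnatr_eq0 -lt0n. Qed.

Lemma avgs_sum s (I : Type) (r : seq I) (P : pred I) (F : I -> V -> R) x :
  avgs s (fun y => \sum_(i <- r | P i) F i y) x =
  \sum_(i <- r | P i) avgs s (F i) x.
Proof.
elim: s x => [//|v s IH] x /=; rewrite /avg -mulr_sumr exchange_big /=.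
by congr (_ * _); apply: eq_bigr => k _.
Qed.

Lemma avgsB s f g x : avgs s (fun y => f y - g y) x = avgs s f x - avgs s g x.
Proof.
elim: s x => [//|v s IH] x /=; rewrite /avg -mulrBr -sumrB.
by congr (_ * _); apply: eq_bigr => k _.
Qed.

Lemma avgs_cst s (c : R) x : avgs s (fun=> c) x = c.
Proof.
elim: s x => [//|v s IH] x /=; rewrite /avg (eq_bigr (fun=> c)) //.
by rewrite sumr_const card_ord -(mulr_natl c) mulKf.
Qed.

Lemma avgs_diffq s v f x : avgs s (diffq h v f) x = diffq h v (avgs s f) x.
Proof.
elim: s x => [//|u s IH] x /=; rewrite /diffq /avg -mulrBr mulrCA -sumrB.
congr (_ * _); rewrite mulr_sumr; apply: eq_bigr => k _.
by rewrite IH /diffq addrCA.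
Qed.

Lemma avg_le v f x (b : R) :
  (forall k, (k < N)%N -> `|f ((h *+ k) *: v + x)| <= b) -> `|avg v f x| <= b.
Proof.
move=> fb; rewrite /avg normrM normfV normr_nat ler_pdivrMl ?ltr0n //.
apply: (le_trans (ler_norm_sum _ _ _)).
rewrite mulr_natl -[in leRHS](card_ord N) -sumr_const.
by apply: ler_sum => k _; exact: fb.
Qed.

(** The average at [x] samples [f] only at points that are reached from [x] by
    at most [N] steps [h v] for each [v] in [s], so a bound on a ball about [x]
    of the corresponding radius is enough. *)
Lemma avgs_le s f x (b : R) :
  (forall y, `|y - x| <= N%:R * h * \sum_(v <- s) `|v| -> `|f y| <= b) ->
  `|avgs s f x| <= b.
Proof.
elim: s x => [|v s IH] x fb /=.
  by apply: fb; rewrite subrr normr0 big_nil mulr0.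
apply: avg_le => k kN; apply: IH => y yx; apply: fb.
rewrite big_cons mulrDr [leRHS]addrC.
rewrite (_ : y - x = (y - ((h *+ k) *: v + x)) + (h *+ k) *: v); last first.
  by rewrite opprD addrA addrAC addrNK.
apply: (le_trans (ler_normD _ _)); apply: lerD => //.
rewrite normrZ ler_wpM2r // normrMn gtr0_norm // mulr_natl.
by rewrite ler_wpMn2l ?ltW // ltnW.
Qed.

Lemma avg_diffq v f x :
  avg v (diffq h v f) x = (N%:R * h)^-1 * (f ((h *+ N) *: v + x) - f x).
Proof.
rewrite /avg /diffq -mulr_sumr mulrA -invfM; congr (_ * _).
pose g k := f ((h *+ k) *: v + x).
rewrite (eq_bigr (fun k : 'I_N => g k.+1 - g k)).
  rewrite -(big_mkord xpredT (fun k => g k.+1 - g k)).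
  by rewrite telescope_sumr // /g scale0r add0r.
by move=> k _; rewrite addrA -scalerDl -mulrS.
Qed.

(** Averaging commutes with difference quotients, so the quotient can be moved
    next to the average along its own direction [v], where the sum
    telescopes. *)
Lemma avgs_diffq_le s v f x (b : R) : v \in s -> (forall y, `|f y| <= b) ->
  `|avgs s (diffq h v f) x| <= 2 * b / (N%:R * h).
Proof.
move=> vs fb; elim: s x vs => [//|u s IH] x.
rewrite inE => /orP[/eqP <-|vs] /=; last by apply: avg_le => k _; exact: IH.
have -> : avgs s (diffq h v f) = diffq h v (avgs s f).
  by apply/funext => y; exact: avgs_diffq.
have Nh : 0 < N%:R * h by rewrite mulr_gt0 ?ltr0n.
rewrite avg_diffq normrM gtr0_norm ?invr_gt0 // mulrC ler_pM2r ?invr_gt0 //.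
have sb y : `|avgs s f y| <= b by apply: avgs_le => z _.
by apply: (le_trans (ler_normB _ _)); rewrite mulr_natl mulr2n lerD.
Qed.

End Averages.

(** * Bounded vector fields of constant divergence *)

(** The averaged sum of difference quotients is within [e / 2] of [c] because
    the quotients approximate the derivatives on the ball [K] that contains all
    sampled points, and it is itself at most [e / 2] by telescoping.  The side
    [L] of the lattice box is fixed first, from the bound [b]; the step [h]
    needed for the approximation depends on it through [K]. *)
Lemma constant_divergence_eq0 (R : realType) (n : nat) (I : finType)
    (v : I -> 'rV[R]_n) (F : I -> 'rV[R]_n -> R) (b c : R) :
  (forall i, C1_along (v i) (F i)) -> (forall i x, `|F i x| <= b) ->
  (forall x, \sum_i 'D_(v i) (F i) x = c) -> c = 0.
Proof.
move=> CF Fb divF; apply/eqP; rewrite -normr_le0; apply/ler_addgt0Pl => e e0.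
rewrite addr0; set s := [seq v i | i <- enum I].
have [L L0 Lb] : exists2 L : R, 0 < L & #|I|%:R * (2 * b / L) <= e / 2.
  set q := #|I|%:R * (2 * b).
  have L0 : 0 < `|q| * 2 / e + 1.
    by apply: ltr_wpDl => //; rewrite divr_ge0 ?mulr_ge0 // ltW.
  exists (`|q| * 2 / e + 1) => //; rewrite mulrA -/q ler_pdivrMr //.
  have -> : e / 2 * (`|q| * 2 / e + 1) = `|q| + e / 2 by field; lra.
  by have := ler_norm q; lra.
set r := L * \sum_(u <- s) `|u|.
pose K := [set x : 'rV[R]_n | Num.norm x <= r].
have cK : compact K.
  apply: bounded_closed_compact.
    exists r; split; [exact: num_real|move=> M rM x /= xr].
    exact: le_trans xr (ltW rM).
  rewrite /K (_ : [set _ | _] = Num.norm @^-1` [set y | y <= r]) //.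
  apply: closed_comp; [by move=> x _; exact: norm_continuous|exact: closed_le].
(* The summand 1 keeps the divisor positive when I is empty. *)
set d := e / 2 / (#|I|%:R + 1).
have d0 : 0 < d by rewrite !divr_gt0 // ltr_wpDl.
have : \forall h \near 0^'+,
    forall i x, K x -> `|diffq h (v i) (F i) x - 'D_(v i) (F i) x| <= d.
  by apply: filter_forall => i; exact: diffq_uniform_on_compact.
move=> [t /= t0 tP].
pose N := (Num.truncn (L / t)).+1; pose h := L / N%:R.
have N0 : 0 < N%:R :> R by rewrite ltr0n.
have h0 : 0 < h by rewrite divr_gt0.
have Nh : N%:R * h = L by rewrite /h mulrCA mulfV ?mulr1 ?gt_eqF.
have hP i x : K x -> `|diffq h (v i) (F i) x - 'D_(v i) (F i) x| <= d.
  apply: tP => //=; rewrite sub0r normrN gtr0_norm // /h.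
  by rewrite ltr_pdivrMr // mulrC -ltr_pdivrMr // truncnS_gt.
have sum_small : `|\sum_i avgs h N s (diffq h (v i) (F i)) 0| <= e / 2.
  apply: (le_trans (ler_norm_sum _ _ _)); apply: le_trans Lb.
  rewrite mulr_natl -sumr_const; apply: ler_sum => i _; rewrite -Nh.
  apply: avgs_diffq_le => //; first by rewrite map_f // mem_enum.
have sum_close : `|\sum_i avgs h N s (diffq h (v i) (F i)) 0 - c| <= e / 2.
  rewrite -avgs_sum -[X in _ - X](@avgs_cst _ _ h N _ s c 0) // -avgsB.
  apply: avgs_le => // y; rewrite subr0 Nh => yr.
  rewrite -(divF y) -sumrB; apply: (le_trans (ler_norm_sum _ _ _)).
  apply: (@le_trans _ _ (\sum_(i : I) d)).
    by apply: ler_sum => i _; exact: hP.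
  rewrite sumr_const -[_ *+ _]mulr_natr /d mulrAC ler_pdivrMr ?ltr_wpDl //.
  by rewrite ler_pM2l ?divr_gt0 // lerDl.
rewrite -[c](subKr (\sum_i avgs h N s (diffq h (v i) (F i)) 0)).
by apply: (le_trans (ler_normB _ _)); lra.
Qed.

(** * The exterior derivative of the flux form *)

Section Forms.
Context {R : realType} {m : nat}.
Implicit Types (a w : dform R m) (K J : {set 'I_m}) (i j : 'I_m).

(** The coefficient of [dx_K] in [dx_i /\ dx_(K :\ i)], extended by 0 to all
    [i]. *)
Definition extd_coef K i : R := (i \in K)%:R * shuffle_sign [set i]%SET (K :\ i).

Lemma norm_shuffle_sign K J : `|shuffle_sign K J : R| = 1.
Proof. by rewrite /shuffle_sign normrX normrN1 expr1n. Qed.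

Lemma extd_coef_le1 K i : `|extd_coef K i| <= 1.
Proof.
rewrite /extd_coef normrM norm_shuffle_sign mulr1 normr_nat.
by case: (i \in K); rewrite ?ler01.
Qed.

Lemma extdE a x K :
  extd a x K = \sum_i extd_coef K i * partial i (fun y => a y (K :\ i)) x.
Proof.
rewrite /extd sum_ffunE; apply: eq_bigr => i _; rewrite ffunE /extd_coef.
have [iK|iK] := boolP (i \in K).
  rewrite (bigD1 [set i]%SET) /= ?finset.sub1set // big1 ?addr0.
    by rewrite !ffunE eqxx !mul1r.
  by move=> I /andP[_ /negPf Ii]; rewrite ffunE Ii mul0r mulr0.
rewrite mul0r mul0r big1 // => I IK; rewrite ffunE.
have /negPf -> : I != [set i]%SET; last by rewrite mul0r mulr0.
by apply: contraNneq iK => Ii; rewrite -finset.sub1set -Ii.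
Qed.

Lemma smooth_partial_C1 (f : 'rV[R]_m -> R) i j :
  smooth_fun f -> C1_along (delta_mx 0 j) (partial i f).
Proof.
move=> sf; have [cD dD] := sf [:: i].
by split=> //; have [cDD _] := sf [:: j; i]; exact: cDD.
Qed.

Lemma extd_C1 w J j : smooth_form w ->
  C1_along (delta_mx 0 j) (fun y => extd w y J).
Proof.
move=> sw; under eq_fun do rewrite extdE.
apply: C1_along_sum => i; apply: C1_alongM; first exact: C1_along_cst.
exact: smooth_partial_C1.
Qed.

(** The nonlinear map [b |-> * (b / sqrt (1 + |b|^2))]. *)
Definition flux (b : extalg R m) : extalg R m :=
  hodge ((Num.sqrt (1 + extnorm b ^+ 2))^-1 *: b).

Lemma extdot_ge0 (b : extalg R m) : 0 <= extdot b b.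
Proof. by apply: sumr_ge0 => I _; rewrite -expr2 sqr_ge0. Qed.

(** Writes [|b|^2] as a polynomial in the coefficients: [extnorm] itself is not
    differentiable where [b] vanishes. *)
Lemma fluxE (b : extalg R m) K :
  flux b K = shuffle_sign (~: K) K *
             ((Num.sqrt (1 + extdot b b))^-1 * b (~: K)%SET).
Proof. by rewrite /flux ffunE ffunE /extnorm sqr_sqrtr // extdot_ge0. Qed.

Lemma flux_le1 (b : extalg R m) K : `|flux b K| <= 1.
Proof.
have b0 := extdot_ge0 b.
rewrite fluxE normrM norm_shuffle_sign mul1r normrM normfV.
have s0 : 0 < Num.sqrt (1 + extdot b b) by rewrite sqrtr_gt0; lra.
rewrite (gtr0_norm s0) ler_pdivrMl // mulr1 -sqrtr_sqr ler_sqrt; last by lra.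
rewrite /extdot (bigD1 (~: K)%SET) //= addrCA -expr2 lerDl.
by rewrite addr_ge0 // sumr_ge0 // => I _; rewrite -expr2 sqr_ge0.
Qed.

Lemma flux_C1 w K j : smooth_form w ->
  C1_along (delta_mx 0 j) (fun y => flux (extd w y) K).
Proof.
move=> sw; under eq_fun do rewrite fluxE.
have pos y : 0 < 1 + extdot (extd w y) (extd w y).
  by have := extdot_ge0 (extd w y); lra.
apply: C1_alongM; first exact: C1_along_cst.
apply: C1_alongM; last exact: extd_C1.
apply: C1_alongV; first by move=> y; rewrite gt_eqF // sqrtr_gt0.
apply: C1_along_sqrt => //; apply: C1_alongD; first exact: C1_along_cst.
by apply: C1_along_sum => I; apply: C1_alongM; exact: extd_C1.
Qed.

End Forms.

Theorem theorem9p1 (R : realType) (m p : nat) (hp : (p < m)%N)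
    (xi0 : dform R m) (hxi0 : has_degree (m - p) xi0)
    (cxi0 : constant_form xi0)
    (w : dform R m) (hw : has_degree p w) (sw : smooth_form w)
    (heq : forall x : 'rV[R]_m,
       extd (fun y => hodge ((Num.sqrt (1 + extnorm (extd w y) ^+ 2))^-1
                              *: extd w y)) x
       = xi0 x) :
  forall x : 'rV[R]_m, xi0 x = 0.
Proof.
move=> x; apply/ffunP => K; rewrite [RHS]ffunE.
pose F i y := extd_coef K i * flux (extd w y) (K :\ i).
have FC1 i j : C1_along (delta_mx 0 j) (F i).
  by apply: C1_alongM; [exact: C1_along_cst|exact: flux_C1].
apply: (@constant_divergence_eq0 R m _ (delta_mx 0) F 1) => [//|i y|y].
  by rewrite normrM mulr_ile1 ?extd_coef_le1 ?flux_le1.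
rewrite (cxi0 x y) -heq extdE; apply: eq_bigr => i _.
have [_ df _] := @flux_C1 R m w (K :\ i) i sw.
exact: deriveMl (df y).
Qed.
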